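(* Let $n$ and $k$ be positive integers and let $p$ be a prime such that $p^2 \mid k$. If there exists a matrix $H \in \mathrm{BH}(n,k)$, then there exists a matrix $H' \in \mathrm{BH}(np, k/p)$.
   Context: For positive integers $n,k$, $\mathrm{BH}(n,k)$ denotes the set of $n\times n$ Butson-Hadamard matrices: $n \times n$ complex matrices $H$ all of whose entries are complex $k^{\text{th}}$ roots of unity and which satisfy $HH^* = nI_n$, where $H^*$ is the conjugate transpose of $H$ and $I_n$ is the $n\times n$ identity matrix. *)

(* Defs.v *)
From HB Require Import structures.
From mathcomp Require Import all_boot all_order all_algebra.
From mathcomp Require Import sesquilinear spectral.
From mathcomp Require Import classical_sets reals.
From mathcomp Require Import complex.
Set Implicit Arguments.
Unset Strict Implicit.
Unset Printing Implicit Defensive.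
Import Order.TTheory GRing.Theory Num.Theory.
Local Open Scope ring_scope.
Local Open Scope sesquilinear_scope.

Definition BH (R : realType) (n k : nat) : set 'M[R[i]]_n :=
  fun H => (forall i j, k.-unity_root (H i j)) /\ H *m H^t* = n%:R%:M.
Arguments BH : clear implicits.

(* Main.v *)
(** Let [z] be a primitive [k]-th root of unity, [m = k / p], [w = z ^ m], and
    write [H i j = z ^ (e i j)].  Replacing [z] by the [p x p] companion matrix
    of [X ^ p - z ^ p], whose powers are monomial matrices over the [m]-th roots
    of unity, and multiplying each block by the Fourier matrix of order [p]
    gives the matrix whose entry at [((i, a), (j, b))] is
    [z ^ (p * (s %/ p)) * w ^ (s * b)], where [s = a + e i j].
    Since [p] divides [m], each [1 + t m] is prime to [k], so [z |-> z ^ (1 + t m)]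
    is a Galois conjugation.  Averaging the conjugates of a vanishing sum of
    powers of [z] shows that its subsum over each residue class of exponents
    modulo [p] vanishes too, and the inner products of rows of the new matrix
    are, up to a factor, such subsums of the inner products of rows of [H]. *)

Require Import Defs.
From mathcomp Require Import all_boot all_order all_algebra.
From mathcomp Require Import algC cyclotomic.
From mathcomp Require Import reals complex.

Set Implicit Arguments.
Unset Strict Implicit.
Unset Printing Implicit Defensive.
Import Order.TTheory GRing.Theory Num.Theory.

Section Cyclotomic.
Local Open Scope ring_scope.

(** 'X^n - 1 is the product of the 'Phi_d with d dividing n, so [z] is a root of one of them; that
    factor divides 'X^d - 1, which forces d = n. *)
Lemma root_Cyclotomic_prim (F : idomainType) (n : nat) (z : F) :
  n.-primitive_root z -> root (map_poly intr 'Phi_n) z.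
Proof.
move=> prim_z; have n_gt0 := prim_order_gt0 prim_z.
have mapXn1 d : map_poly intr ('X^d - 1 : {poly int}) = 'X^d - 1 :> {poly F}.
  by rewrite rmorphB /= rmorph1 map_polyXn.
have: root (map_poly intr ('X^n - 1)) z.
  by rewrite mapXn1; apply/unity_rootP/prim_expr_order.
rewrite -prod_Cyclotomic // rmorph_prod /= rootE horner_prod prodf_seq_eq0.
case/hasP=> d; rewrite -dvdn_divisors //= => d_n rd.
suff zd1 : z ^+ d = 1.
  suff <- : d = n by [].
  by apply/eqP; rewrite eqn_dvd d_n (prim_order_dvd prim_z) zd1 eqxx.
have d_gt0 := dvdn_gt0 n_gt0 d_n.
apply/unity_rootP; rewrite /root_of_unity -mapXn1 -prod_Cyclotomic //.
rewrite rmorph_prod /= rootE horner_prod prodf_seq_eq0; apply/hasP.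
by exists d; rewrite // -dvdn_divisors.
Qed.

Lemma map_ratr_intr (F : numFieldType) (f : {poly int}) :
  map_poly (@ratr F) (map_poly intr f) = map_poly intr f.
Proof.
by rewrite -map_poly_comp; apply: eq_map_poly => b; rewrite /= rmorph_int.
Qed.

Lemma Cyclotomic_dvdp_rat (n : nat) (y : algC) (q : {poly rat}) :
  n.-primitive_root y ->
  (map_poly intr 'Phi_n %| q) = root (map_poly ratr q) y.
Proof.
move=> prim_y; have [pf [Dpf _] ->] := minCpolyP y.
rewrite -[LHS](dvdp_map (@ratr algC)) -[RHS](dvdp_map (@ratr algC)) -Dpf.
rewrite (minCpoly_cyclotomic prim_y) -(Cintr_Cyclotomic prim_y).
by rewrite map_ratr_intr.
Qed.

(** Irreducibility of 'Phi_n over the rationals, carried from [algC] to [F]. A common root in [F]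
    makes the rational gcd nonconstant; the gcd then has a root in [algC], a primitive n-th root of
    unity with minimal polynomial 'Phi_n. *)
Lemma Cyclotomic_dvdp_root (F : numFieldType) (n : nat) (z : F)
    (q : {poly rat}) :
  n.-primitive_root z -> root (map_poly ratr q) z ->
  map_poly intr 'Phi_n %| q.
Proof.
move=> prim_z qz0; have n_gt0 := prim_order_gt0 prim_z.
set Phi : {poly rat} := map_poly intr 'Phi_n.
have: ~~ coprimep Phi q.
  apply/negP; rewrite -(coprimep_map (@ratr F)) => /coprimep_root.
  move/(_ z); rewrite map_ratr_intr root_Cyclotomic_prim // => /(_ isT).
  by rewrite -rootE qz0.
rewrite /coprimep -(size_map_poly (@ratr algC)) => /closed_rootP[y].
have [x prim_x] := C_prim_root_exists n_gt0.
rewrite gcdp_map root_gcd map_ratr_intr (Cintr_Cyclotomic prim_x) root_cyclotomic //.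
by case/andP=> prim_y; rewrite -(Cyclotomic_dvdp_rat _ prim_y).
Qed.

(** Galois conjugation stated on polynomials: [z] and [z ^+ c] are both roots of 'Phi_n, which
    divides [q]. *)
Lemma root_ratr_prim_conj (F : numFieldType) (n c : nat) (z : F)
    (q : {poly rat}) :
  n.-primitive_root z -> coprime c n ->
  root (map_poly ratr q) z -> root (map_poly ratr q) (z ^+ c).
Proof.
move=> prim_z co_c /(Cyclotomic_dvdp_root prim_z)/dvdpP[r ->].
rewrite rmorphM rootM /= map_ratr_intr.
by rewrite root_Cyclotomic_prim ?orbT // prim_root_exp_coprime.
Qed.

Lemma prim_root_exists (F : numClosedFieldType) (n : nat) :
  (0 < n)%N -> exists z : F, n.-primitive_root z.
Proof.
move=> n_gt0; have [x prim_x] := C_prim_root_exists n_gt0.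
pose Phi : {poly rat} := map_poly intr 'Phi_n.
have [y Phiy0] : exists y : F, root (map_poly ratr Phi) y.
  apply/closed_rootP; rewrite size_map_poly size_map_inj_poly //.
    by rewrite size_Cyclotomic eqSS -lt0n totient_gt0.
  exact: intr_inj.
have mapXn1 (L : numFieldType) :
    map_poly ratr ('X^n - 1 : {poly rat}) = 'X^n - 1 :> {poly L}.
  by rewrite rmorphB /= rmorph1 map_polyXn.
have /dvdpP[q Dq] : Phi %| 'X^n - 1.
  rewrite (Cyclotomic_dvdp_rat _ prim_x) mapXn1.
  exact/unity_rootP/prim_expr_order.
have yn1 : y ^+ n = 1.
  apply/unity_rootP; rewrite /root_of_unity -mapXn1 Dq rmorphM rootM /=.
  by rewrite Phiy0 orbT.
(* If [y] has order [m], then 'Phi_m divides 'Phi_n over the rationals, so a primitive m-th root of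
   unity in [algC] is also a primitive n-th one. *)
have [m prim_y m_n] := prim_order_exists n_gt0 yn1.
exists y; suff -> : n = m by [].
apply/eqP; rewrite eqn_dvd m_n andbT.
have [u prim_u] := C_prim_root_exists (prim_order_gt0 prim_y).
have := Cyclotomic_dvdp_root prim_y Phiy0.
rewrite (Cyclotomic_dvdp_rat _ prim_u) map_ratr_intr (Cintr_Cyclotomic prim_x).
rewrite root_cyclotomic // => prim_nu.
by rewrite (prim_order_dvd prim_nu) (prim_expr_order prim_u).
Qed.

Lemma conj_prim_root (F : numClosedFieldType) (n : nat) (z : F) :
  n.-primitive_root z -> z^* = z^-1.
Proof.
move=> prim_z; have n_gt0 := prim_order_gt0 prim_z.
rewrite invC_norm; suff -> : `|z| = 1 by rewrite expr1n invr1 mul1r.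
apply/eqP; rewrite -(@pexpr_eq1 _ _ n) // -normrX (prim_expr_order prim_z).
by rewrite normr1.
Qed.

Lemma prim_root_neq0 (F : fieldType) (n : nat) (z : F) :
  n.-primitive_root z -> z != 0.
Proof.
by move=> prim_z; rewrite (prim_root_eq0 prim_z) -lt0n (prim_order_gt0 prim_z).
Qed.

Lemma sum_prim_root_ratio (F : fieldType) (p : nat) (w : F) (s t : nat) :
  p.-primitive_root w ->
  \sum_(b < p) (w ^+ s / w ^+ t) ^+ b = if s == t %[mod p] then p%:R else 0.
Proof.
move=> prim_w; have w0 := prim_root_neq0 prim_w.
rewrite -(eq_prim_root_expr prim_w) -subr_eq0.
have [/eqP|neq] := ifPn.
  move/subr0_eq=> ->; rewrite divff ?expf_neq0 //.
  by under eq_bigr do rewrite expr1n; rewrite sumr_const card_ord.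
set x := _ / _; have x1 : x - 1 != 0.
  apply: contra neq => /eqP/subr0_eq x1; rewrite subr_eq0; apply/eqP.
  by rewrite -[LHS](divfK (expf_neq0 t w0)) -/x x1 mul1r.
apply: (mulfI x1); rewrite mulr0 -subrX1 /x expr_div_n -!exprM.
by rewrite ![(_ * p)%N]mulnC !exprM (prim_expr_order prim_w) !expr1n divr1 subrr.
Qed.

Lemma sum_ratio_conj (F : numFieldType) (k c : nat) (z : F) (I : finType)
    (f g : I -> nat) :
  k.-primitive_root z -> coprime c k ->
  \sum_j z ^+ f j / z ^+ g j = 0 ->
  \sum_j (z ^+ f j / z ^+ g j) ^+ c = 0.
Proof.
move=> prim_z co_c; have k_gt0 := prim_order_gt0 prim_z.
have z0 := prim_root_neq0 prim_z.
have ratioE (u : F) j : u ^+ k = 1 -> u != 0 ->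
    u ^+ f j / u ^+ g j = u ^+ (f j + g j * k.-1).
  move=> uk u0; apply: (mulIf (expf_neq0 (g j) u0)); rewrite divfK ?expf_neq0 //.
  rewrite -exprD -addnA -mulnSr prednK // exprD mulnC exprM uk expr1n.
  by rewrite mulr1.
(* For a k-th root of unity, inversion is the power [k.-1]; hence both sums are values of one
   polynomial, at [z] and at [z ^+ c]. *)
pose q : {poly rat} := \sum_j 'X^(f j + g j * k.-1).
have qE (u : F) : u ^+ k = 1 -> u != 0 ->
    (map_poly ratr q).[u] = \sum_j u ^+ f j / u ^+ g j.
  move=> uk u0; rewrite rmorph_sum horner_sum; apply: eq_bigr => j _ /=.
  by rewrite map_polyXn hornerXn ratioE.
rewrite -qE ?(prim_expr_order prim_z) // => /eqP.
rewrite -rootE => /(root_ratr_prim_conj prim_z co_c)/rootP.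
rewrite qE ?expf_neq0 //; last first.
  by rewrite exprAC (prim_expr_order prim_z) expr1n.
move=> zc0; rewrite -[RHS]zc0; apply: eq_bigr => j _.
by rewrite expr_div_n -!exprM ![(_ * c)%N]mulnC.
Qed.

Lemma sum_ratio_residue (F : numFieldType) (k p : nat) (z : F) (I : finType)
    (f g : I -> nat) (a b : nat) :
  k.-primitive_root z -> (p ^ 2 %| k)%N ->
  \sum_j z ^+ f j / z ^+ g j = 0 ->
  \sum_(j | a + f j == b + g j %[mod p]) z ^+ f j / z ^+ g j = 0.
Proof.
move=> prim_z p2k sum0; have k_gt0 := prim_order_gt0 prim_z.
have pk : (p %| k)%N by rewrite (dvdn_trans _ p2k) // expnS dvdn_mulr.
have p_gt0 : (0 < p)%N by exact: dvdn_gt0 pk.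
pose m := (k %/ p)%N; have kE : k = (m * p)%N by rewrite divnK.
have pm : (p %| m)%N by rewrite -(dvdn_pmul2r p_gt0) -kE mulnn.
pose w := z ^+ m; have prim_w : p.-primitive_root w by exact: dvdn_prim_root.
(* Every prime factor of k = m * p divides [m], because [p] does. *)
have co t : coprime (1 + t * m) k.
  have com : coprime (1 + t * m) m by rewrite /coprime gcdnC addnC gcdnMDl gcdn1.
  by rewrite kE coprimeMr com (coprime_dvdr pm com).
apply: (mulIf (_ : p%:R != 0)); first by rewrite pnatr_eq0 -lt0n.
rewrite mul0r mulr_suml.
(* The sum over [t] is [p] times the indicator of the congruence. *)
transitivity (\sum_j z ^+ f j / z ^+ g j *
    \sum_(t < p) (w ^+ (a + f j) / w ^+ (b + g j)) ^+ t).
  rewrite big_mkcond; apply: eq_bigr => j _ /=.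
  by rewrite sum_prim_root_ratio //; case: ifP; rewrite ?mulr0.
under eq_bigr do rewrite mulr_sumr.
rewrite exchange_big big1 // => t _ /=.
(* Since [w = z ^+ m], the t-th character twist is absorbed into the exponent [1 + t * m]. *)
transitivity ((w ^+ a / w ^+ b) ^+ t *
    \sum_j (z ^+ f j / z ^+ g j) ^+ (1 + t * m)); last first.
  by rewrite (sum_ratio_conj prim_z (co t) sum0) mulr0.
rewrite mulr_sumr.
apply: eq_bigr => j _.
rewrite [_ ^+ (1 + _)]exprD expr1 mulrCA; congr (_ * _).
rewrite mulnC exprM -exprMn; congr (_ ^+ _).
rewrite expr_div_n -![(z ^+ _) ^+ m]exprM ![(_ * m)%N]mulnC !exprM -/w.
by rewrite !exprD invfM mulrACA.
Qed.

End Cyclotomic.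

Theorem theorem1p1 (R : realType) (n k p : nat) (hn : 0 < n) (hk : 0 < k)
    (hp : prime p) (hpk : p ^ 2 %| k) :
  (exists H : 'M[R[i]]_n, BH R n k H) ->
  exists H' : 'M[R[i]]_(n * p), BH R (n * p) (k %/ p) H'.
Proof.
case=> H [H_unity HH].
have p_gt0 := prime_gt0 hp.
have pk : p %| k by rewrite (dvdn_trans _ hpk) // expnS dvdn_mulr.
pose m := k %/ p; have kE : k = m * p by rewrite divnK.
have pm : p %| m by rewrite -(dvdn_pmul2r p_gt0) -kE mulnn.
have [z prim_z] := @prim_root_exists R[i] k hk.
have z0 := prim_root_neq0 prim_z.
pose w := (z ^+ m)%R.
have prim_w : p.-primitive_root%R w by exact: dvdn_prim_root.
have e_ex i j : {e : 'I_k | H i j = z ^+ e}%R.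
  by apply: (prim_rootP prim_z); apply/unity_rootP/H_unity.
pose e i j : nat := sval (e_ex i j).
have HE i j : (H i j = z ^+ e i j)%R by exact: svalP (e_ex i j).
have conjzX d : ((z ^+ d)^* = (z ^+ d)^-1)%R.
  by rewrite rmorphXn /= (conj_prim_root prim_z) exprVn.
have rows i i' : (\sum_j z ^+ e i j / z ^+ e i' j = n%:R *+ (i == i'))%R.
  move/matrixP: HH => /(_ i i'); rewrite !mxE => <-.
  by apply: eq_bigr => j _; rewrite !mxE !HE conjzX.
pose E (i : 'I_n) (a : 'I_p) (j : 'I_n) (b : 'I_p) :=
  p * ((a + e i j) %/ p) + m * ((a + e i j) * b).
(* [g] decodes an index below [n * p] into its block and its position in the block. *)
have [g gK Kg] := @curry_mxvec_bij n p.
exists (\matrix_(r, c) z ^+ E (g r).1 (g r).2 (g c).1 (g c).2)%R; split.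
  move=> r c; rewrite mxE; apply/unity_rootP; rewrite -exprM.
  (* After raising to the power [m], the exponents are multiples of p * m = k and of m * m, which
     [k] divides. *)
  apply/eqP; rewrite -(prim_order_dvd prim_z) mulnDl.
  rewrite dvdn_add // -/m; first by rewrite mulnAC kE [p * m]mulnC dvdn_mulr.
  by rewrite mulnAC {1}kE dvdn_mulr // dvdn_mul.
have bsum (s s' : nat) :
    (\sum_(b < p) z ^+ (p * (s %/ p) + m * (s * b)) /
       z ^+ (p * (s' %/ p) + m * (s' * b)) =
     if s == s' %[mod p] then z ^+ s / z ^+ s' * p%:R else 0)%R.
  transitivity (z ^+ (p * (s %/ p)) / z ^+ (p * (s' %/ p)) *
      \sum_(b < p) (w ^+ s / w ^+ s') ^+ b)%R.
    rewrite mulr_sumr; apply: eq_bigr => b _.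
    by rewrite !exprD invfM mulrACA expr_div_n /w -!exprM !mulnA.
  rewrite sum_prim_root_ratio //; case: eqP => [ss'|_]; last by rewrite mulr0.
  (* Equal remainders cancel in the ratio, so rounding [s] and [s'] down to multiples of [p] does
     not change it. *)
  congr (_ * _)%R; rewrite {2}(divn_eq s p) {2}(divn_eq s' p) ss' !exprD.
  by rewrite invfM mulrACA divff ?expf_neq0 // mulr1 ![(p * _)%N]mulnC.
apply/matrixP=> r r'; rewrite !mxE (reindex _ (@curry_mxvec_bij n p)) /=.
transitivity (\sum_(j : 'I_n) \sum_(b : 'I_p)
    z ^+ E (g r).1 (g r).2 j b / z ^+ E (g r').1 (g r').2 j b)%R.
  rewrite pair_bigA; apply: eq_bigr => -[j b] _.
  by rewrite !mxE (gK (j, b)) // conjzX.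
under eq_bigr do rewrite bsum.
rewrite -big_mkcond -mulr_suml /=.
have -> : (r == r') = (g r == g r').
  by apply/eqP/eqP => [-> //|grr']; rewrite -[r]Kg // grr' Kg.
case: (g r) (g r') => [i a] [i' a'] /=.
under eq_bigr do rewrite !exprD invfM mulrACA.
rewrite -mulr_sumr xpair_eqE.
have [<-|ii'] := eqVneq i i'; last first.
  by rewrite (sum_ratio_residue _ _ prim_z hpk) ?mulr0 ?mul0r // rows (negPf ii').
(* Within one block row the shifts [e i j] cancel, and [a], [a'] are below [p]: the congruence is
   [a = a'] for every [j]. *)
under eq_bigl do rewrite eqn_modDr !modn_small //.
rewrite val_eqE; have [<-|aa'] := eqVneq a a'; last first.
  by rewrite big_pred0_eq mulr0 mul0r.
by rewrite rows eqxx divff ?expf_neq0 // mul1r natrM.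
Qed.
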